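(* Let $X$ be the circle or the interval and let $T$ be a $\mathrm{Cu}$-semigroup. Let $\alpha,\beta:\mathrm{Lsc}(X,\overline{\mathbb{N}})\to T$ be $\mathrm{Cu}$-morphisms. Let $\mathcal{B}_{2^\infty}:=(\Lambda_n,\epsilon_n)_n$ be the finite uniform basis of $\mathrm{Lsc}(X,\overline{\mathbb{N}})$ associated to $2^\infty$. Then for every $n\ge1$: (i) if $d_{\mathrm{Cu}}(\alpha,\beta)\le 1/2^n$, then $dd_{\mathrm{Cu},\mathcal{B}_{2^\infty}}(\alpha,\beta)\le 1/2^n$; (ii) if $dd_{\mathrm{Cu},\mathcal{B}_{2^\infty}}(\alpha,\beta)\le 1/2^n$, then $d_{\mathrm{Cu}}(\alpha,\beta)\le 2/2^n\le 1/2^{n-1}$.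
   Context: $\overline{\mathbb{N}}=\mathbb{N}\sqcup\{\infty\}$. In a positively ordered monoid (commutative monoid with translation-invariant partial order, $0$ least), $x\ll y$ means: for every increasing sequence $(z_n)_n$ having a supremum with $\sup_n z_n\ge y$ there is $k$ with $x\le z_k$. A $\mathrm{Cu}$-semigroup is a positively ordered monoid such that: (O1) every increasing sequence has a supremum; (O2) every element is the supremum of a $\ll$-increasing sequence; (O3) $x'\ll x$, $y'\ll y$ imply $x'+y'\ll x+y$; (O4) addition commutes with suprema of increasing sequences. A $\mathrm{Cu}$-morphism is an order-preserving monoid homomorphism preserving $\ll$ and suprema of increasing sequences. $\mathrm{Lsc}(X,\overline{\mathbb{N}})$ is the $\mathrm{Cu}$-semigroup of lower-semicontinuous functions $X\to\overline{\mathbb{N}}$ with pointwise order and addition. $X=[0,1]$ with the usual metric, or $X$ is the circle obtained from $[0,1]$ by gluing $0$ and $1$, with the induced arc-length metric of total length $1$. For $n\ge1$ let $U_k=]\frac{k-1}{2^n},\frac{k}{2^n}[$, $1\le k\le 2^n$ (open arcs in the circle case). Then $\Lambda_n$ is the set of lower-semicontinuous $f:X\to\{0,1\}$ that are constant on each $U_k$; $M_n$ is the set of $f\in\mathrm{Lsc}(X,\mathbb{N})$ constant on each $U_k$, and $\epsilon_n(f)=\max\{g\in M_n: g\ll f\}$. For $\Lambda\subseteq\mathrm{Lsc}(X,\overline{\mathbb{N}})$ write $\alpha\underset{\Lambda}{\simeq}\beta$ if for all $g',g\in\Lambda$ with $g'\ll g$ one has $\alpha(g')\le\beta(g)$ and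 $\beta(g')\le\alpha(g)$. Set $dd_{\mathrm{Cu},\mathcal{B}_{2^\infty}}(\alpha,\beta):=\inf\{\frac1{2^n}: \alpha\underset{\Lambda_n}{\simeq}\beta\}$ (over $n\ge1$; value $\infty$ if there is no such $n$). For an open set $V\subseteq X$ and $r>0$ let $V_r=\bigcup_{x\in V}B_r(x)$ (open balls). Set $d_{\mathrm{Cu}}(\alpha,\beta):=\inf\{r>0: \text{for all open } V\subseteq X,\ \alpha(1_V)\le\beta(1_{V_r})\text{ and }\beta(1_V)\le\alpha(1_{V_r})\}$. *)

(* Defs.v *)
From HB Require Import structures.
From mathcomp Require Import all_boot all_order all_algebra.
From mathcomp Require Import generic_quotient.
From mathcomp Require Import all_classical all_reals.
From mathcomp Require Import ereal numfun topology normedtype sequences.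
From mathcomp Require Import lra.

Set Implicit Arguments.
Unset Strict Implicit.
Unset Printing Implicit Defensive.

Import Order.TTheory GRing.Theory Num.Theory.
Import numFieldTopology.Exports numFieldNormedType.Exports.

Local Open Scope classical_set_scope.
Local Open Scope ring_scope.

(* The monoid operations are separate fields on top of [porderType]:
   Hierarchy-Builder rejects a join of [nmodType] and [porderType] that is not
   below [porderZmodType]. *)
HB.mixin Record isPosOrderedMonoid (d : Order.disp_t) T & Order.POrder d T := {
  pom0 : T;
  pom_add : T -> T -> T;
  pom_addA : associative pom_add;
  pom_addC : commutative pom_add;
  pom_add0 : left_id pom0 pom_add;
  pom_leD2r : forall z x y : T, (x <= y)%O -> (pom_add x z <= pom_add y z)%O;
  pom_ge0 : forall x : T, (pom0 <= x)%O
}.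

#[short(type="pomType")]
HB.structure Definition PosOrderedMonoid (d : Order.disp_t) :=
  { T of Order.POrder d T & isPosOrderedMonoid d T }.

Definition is_sup (d : Order.disp_t) (T : porderType d) (z : nat -> T) (s : T) :=
  supremums (range z) s.

Definition way_below (d : Order.disp_t) (T : porderType d) (x y : T) :=
  forall (z : nat -> T) (s : T),
    nondecreasing_seq z -> is_sup z s -> (y <= s)%O -> exists k, (x <= z k)%O.

Notation "x '<<<' y" := (way_below x y) (at level 70, no associativity).

HB.mixin Record isCuSemigroup (d : Order.disp_t) T & PosOrderedMonoid d T := {
  Cu_O1 : forall z : nat -> T, nondecreasing_seq z -> exists s, is_sup z s;
  Cu_O2 : forall x : T,
    exists z : nat -> T, (forall n, z n <<< z n.+1) /\ is_sup z x;
  Cu_O3 : forall x' x y' y : T,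
    x' <<< x -> y' <<< y -> pom_add x' y' <<< pom_add x y;
  Cu_O4 : forall (z w : nat -> T) (s t : T),
    nondecreasing_seq z -> nondecreasing_seq w -> is_sup z s -> is_sup w t ->
    is_sup (fun n => pom_add (z n) (w n)) (pom_add s t)
}.

#[short(type="cuSemigroupType")]
HB.structure Definition CuSemigroup (d : Order.disp_t) :=
  { T of PosOrderedMonoid d T & isCuSemigroup d T }.

(* Stated for positively ordered monoids because (O1)-(O4) play no role in the
   definition; this covers [Lsc R X] without an instance of
   [cuSemigroupType] for it. *)
Record Cu_morphism (d d' : Order.disp_t) (S : pomType d) (T : pomType d')
    (f : S -> T) : Prop := {
  Cu_morph0 : f pom0 = pom0;
  Cu_morphD : forall x y, f (pom_add x y) = pom_add (f x) (f y);
  Cu_morph_le : forall x y, (x <= y)%O -> (f x <= f y)%O;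
  Cu_morph_way_below : forall x y, x <<< y -> f x <<< f y;
  Cu_morph_sup : forall (z : nat -> S) (s : S),
    nondecreasing_seq z -> is_sup z s -> is_sup (f \o z) (f s)
}.

(* The natural numbers with infinity, inside the extended reals, from which
   they inherit order, addition and lower semicontinuity. *)
Definition nbar (R : realType) : set (\bar R) :=
  range (fun m : nat => m%:R%:E) `|` [set +oo%E].

Lemma nbar_ge0 (R : realType) (x : \bar R) : nbar x -> (0 <= x)%E.
Proof. by move=> [[m _ <-]|->]; rewrite ?lee_fin ?ler0n// le0y. Qed.

Lemma nbarD (R : realType) (x y : \bar R) : nbar x -> nbar y -> nbar (x + y)%E.
Proof.
move=> [[m _ <-]|->] [[k _ <-]|->]; try by right.
by left; exists (m + k)%N => //; rewrite natrD EFinD.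
Qed.

Section Lsc.
Context (R : realType) (X : topologicalType).

Definition is_lsc : {pred X -> \bar R} :=
  fun f => `[< lower_semicontinuous f /\ forall x, nbar (f x) >].

Record Lsc := MkLsc { Lsc_fun :> X -> \bar R; Lsc_funP : Lsc_fun \in is_lsc }.

HB.instance Definition _ := [isSub for Lsc_fun].
HB.instance Definition _ := [Choice of Lsc by <:].
HB.instance Definition _ := 
  [SubChoice_isSubPOrder of Lsc by <: with FunOrder.fun_display].

Lemma le_LscP (f g : Lsc) : (f <= g)%O <-> forall x, (f x <= g x)%E.
Proof. by rewrite leEsub; split => /lefP. Qed.

Lemma is_lsc0 : (fun=> 0%E) \in is_lsc.
Proof.
apply/asboolP; split; last by left; exists 0%N.
by move=> x a a0; exists setT => //; exact: filterT.
Qed.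

Lemma is_lscD (f g : Lsc) : (f \+ g)%E \in is_lsc.
Proof.
have /asboolP[lf nf] := Lsc_funP f; have /asboolP[lg ng] := Lsc_funP g.
apply/asboolP => /=.
split=> [x a afg|x]; last exact: nbarD.
have [b [c [bf cg abc]]] : exists b c : R,
    [/\ (b%:E < f x)%E, (c%:E < g x)%E & a <= b + c].
  move: afg (nbar_ge0 (nf x)) (nbar_ge0 (ng x)).
  case: (f x) => [u| |]//; case: (g x) => [v| |]//= H Hf Hg.
  - exists (u - (u + v - a) / 2), (v - (u + v - a) / 2).
    by move: H Hf Hg; rewrite -EFinD !lte_fin !lee_fin => *; split; lra.
  - by exists (u - 1), (a - u + 1); rewrite lte_fin ltry; split => //; lra.
  - by exists (a - v + 1), (v - 1); rewrite lte_fin ltry; split => //; lra.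
  - by exists a, 0; rewrite !ltry addr0; split.
have [V Vx Vf] := lf x b bf; have [W Wx Wg] := lg x c cg.
exists (V `&` W); first exact: filterI.
move=> y [Vy Wy]; rewrite (@le_lt_trans _ _ (b%:E + c%:E)%E)//.
exact: lteD (Vf y Vy) (Wg y Wy).
Qed.

Definition Lsc0 := MkLsc is_lsc0.
Definition Lsc_add (f g : Lsc) := MkLsc (is_lscD f g).

Let Lsc_addA : associative Lsc_add.
Proof. by move=> f g h; apply/val_inj/funext => x /=; rewrite addeA. Qed.

Let Lsc_addC : commutative Lsc_add.
Proof. by move=> f g; apply/val_inj/funext => x /=; rewrite addeC. Qed.

Let Lsc_add0 : left_id Lsc0 Lsc_add.
Proof. by move=> f; apply/val_inj/funext => x /=; rewrite add0e. Qed.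

Let Lsc_leD2r (h f g : Lsc) : (f <= g)%O -> (Lsc_add f h <= Lsc_add g h)%O.
Proof. by move=> /le_LscP fg; apply/le_LscP => x /=; rewrite leeD2r. Qed.

Let Lsc_ge0 (f : Lsc) : (Lsc0 <= f)%O.
Proof.
apply/le_LscP => x /=; apply: nbar_ge0.
by have /asboolP[] := Lsc_funP f.
Qed.

HB.instance Definition _ := isPosOrderedMonoid.Build _ Lsc
  Lsc_addA Lsc_addC Lsc_add0 Lsc_leD2r Lsc_ge0.

Lemma is_lsc_indic (V : set X) : open V -> EFin \o \1_V \in is_lsc.
Proof.
move=> oV; apply/asboolP; split=> [x a /=|x]; last first.
  by left; exists (x \in V) => //; rewrite /= indicE.
rewrite indicE; case: (boolP (x \in V)) => [/set_mem Vx a1|_ a0].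
  exists V; first exact: open_nbhs_nbhs.
  by move=> y Vy; rewrite indicE mem_set.
exists setT => [|y _]; first exact: filterT.
by rewrite (lt_le_trans a0)// lee_fin indicE.
Qed.

Definition Lsc_indic (V : set X) (oV : open V) := MkLsc (is_lsc_indic oV).

End Lsc.

Section metric_spaces.
Context (R : realType).

Definition unit_itv : Type := set_type (`[0, 1]%classic : set R).

HB.instance Definition _ := PseudoMetric.copy unit_itv
  (set_type (`[0, 1]%classic : set R)).

Definition itv_dist (s t : unit_itv) : R := `|val s - val t|.

Let itv_dist_ge0 s t : 0 <= itv_dist s t.
Proof. exact: normr_ge0. Qed.

Let itv_dist_positivity s t : itv_dist s t = 0 -> s = t.
Proof. by move/normr0_eq0/eqP; rewrite subr_eq0 => /eqP /val_inj. Qed.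

Let itv_ballE s r : ball s r = [set t | itv_dist s t < r].
Proof. by []. Qed.

HB.instance Definition _ := PseudoMetric_isMetric.Build R unit_itv
  itv_dist_ge0 itv_dist_positivity itv_ballE.

Definition endpoint (s : unit_itv) := (val s == 0) || (val s == 1).

Definition glue (s t : unit_itv) := (s == t) || (endpoint s && endpoint t).

Let glue_refl : reflexive glue.
Proof. by move=> s; rewrite /glue eqxx. Qed.

Let glue_sym : symmetric glue.
Proof. by move=> s t; rewrite /glue eq_sym andbC. Qed.

Let glue_trans : transitive glue.
Proof.
move=> t s u /orP[/eqP->//|/andP[es et]] /orP[/eqP<-|/andP[_ eu]].
  by rewrite /glue es et orbT.
by rewrite /glue es eu orbT.
Qed.

Canonical glue_equiv := EquivRel glue glue_refl glue_sym glue_trans.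

Definition circle : Type := {eq_quot glue}%qT.

HB.instance Definition _ := Choice.on circle.

Definition circle_pi (s : unit_itv) : circle := (\pi_{eq_quot glue} s)%qT.

Definition arc_dist (s t : unit_itv) : R :=
  Num.min `|val s - val t| (1 - `|val s - val t|).

Definition circle_dist (x y : circle) : R :=
  arc_dist (repr (x : {eq_quot glue})%qT) (repr (y : {eq_quot glue})%qT).

Let arcxx s : arc_dist s s = 0.
Proof. by rewrite /arc_dist subrr normr0 subr0 minEle ler01. Qed.

Let arcC s t : arc_dist s t = arc_dist t s.
Proof. by rewrite /arc_dist distrC. Qed.

Let unitP (s : unit_itv) : 0 <= val s <= 1.
Proof. by have := valP s; rewrite inE/= in_itv. Qed.

Let arc0 s t : arc_dist s t = 0 -> glue s t.
Proof.
move: (unitP s) (unitP t) => /andP[s0 s1] /andP[t0 t1].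
rewrite /arc_dist /glue /endpoint -val_eqE /= minEle; case: ifPn => _ h.
  by rewrite -subr_eq0 (normr0_eq0 h) eqxx.
have {}h : `|val s - val t| = 1 by lra.
apply/orP; right; case: (lerP (val t) (val s)) => ts.
  rewrite ger0_norm ?subr_ge0// in h.
  have -> : val s = 1 by lra.
  have -> : val t = 0 by lra.
  by rewrite !eqxx orbT.
rewrite ltr0_norm ?subr_lt0// in h.
have -> : val s = 0 by lra.
have -> : val t = 1 by lra.
by rewrite !eqxx orbT.
Qed.

Let arc_triangle t s u : arc_dist s u <= arc_dist s t + arc_dist t u.
Proof.
rewrite /arc_dist; set a := `|val s - val t|; set b := `|val t - val u|.
set c := `|val s - val u|.
have h1 : c <= a + b by exact: ler_distD.
have h2 : b <= a + c by rewrite /a distrC; exact: ler_distD.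
have h3 : a <= c + b by rewrite /b distrC; exact: ler_distD.
have h4 : a + b + c <= 2.
  move: (unitP s) (unitP t) (unitP u); rewrite /a /b /c.
  move: (val s) (val t) (val u) => x y z.
  move=> /andP[x0 x1] /andP[y0 y1] /andP[z0 z1]; clear -x0 x1 y0 y1 z0 z1.
  by case: (ger0P (x - y)); case: (ger0P (y - z)); case: (ger0P (x - z)); lra.
move: a b c h1 h2 h3 h4 => a b c h1 h2 h3 h4.
clear -h1 h2 h3 h4.
rewrite ge_min; case: (leP a (1 - a)) => ha; case: (leP b (1 - b)) => hb.
- by rewrite h1.
- by apply/orP; right; lra.
- by apply/orP; right; lra.
- by apply/orP; left; lra.
Qed.

Let circle_distxx x : circle_dist x x = 0.
Proof. exact: arcxx. Qed.

Let circle_dist_positivity x y : circle_dist x y = 0 -> x = y.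
Proof.
move=> /arc0 xy; rewrite -[x]reprK -[y]reprK; exact/eqmodP.
Qed.

Let circle_dist_sym x y : circle_dist x y = circle_dist y x.
Proof. exact: arcC. Qed.

Let circle_dist_triangle y x z :
  circle_dist x z <= circle_dist x y + circle_dist y z.
Proof. exact: arc_triangle. Qed.

HB.instance Definition _ := isMetric.Build R circle
  circle_distxx circle_dist_positivity circle_dist_sym circle_dist_triangle.

Let arc_glue s s' t : glue s s' -> arc_dist s t = arc_dist s' t.
Proof.
move: (unitP t) => /andP[t0 t1].
move=> /orP[/eqP->//|/andP[/orP[]/eqP es /orP[]/eqP es']];
  rewrite /arc_dist es es' // sub0r normrN (ger0_norm t0);
  rewrite (@ger0_norm _ (1 - _)) ?subr_ge0//;
  by rewrite subKr minC.
Qed.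

Lemma circle_dist_pi s t : mdist (circle_pi s) (circle_pi t) = arc_dist s t.
Proof.
have glue_pi u : glue (repr (\pi_{eq_quot glue} u))%qT u.
  by apply/eqmodP; rewrite reprK.
rewrite [LHS](arc_glue _ (glue_pi s)) arcC.
by rewrite [LHS](arc_glue _ (glue_pi t)) arcC.
Qed.

End metric_spaces.

Variant circle_or_interval := Interval | Circle.

Definition base_space (R : realType) (X : circle_or_interval) :
    metricType R :=
  match X with Interval => unit_itv R | Circle => circle R end.

Definition base_proj (R : realType) (X : circle_or_interval) :
    unit_itv R -> base_space R X :=
  match X with Interval => id | Circle => @circle_pi R end.

Section dyadic_basis.
Context (R : realType) (X : circle_or_interval).
Local Notation L := (Lsc R (base_space R X)).

(* [cell n k] is the open interval or arc ](k - 1) / 2 ^ n, k / 2 ^ n[. *)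
Definition cell (n k : nat) : set (base_space R X) :=
  @base_proj R X @`
    [set t | (k%:R - 1) / 2 ^+ n < val t :> R /\ val t < k%:R / 2 ^+ n :> R].

Definition cellwise_constant (n : nat) (f : L) :=
  forall k, (1 <= k <= 2 ^ n)%N ->
  forall x y, cell n k x -> cell n k y -> f x = f y.

Definition Lambda_dyadic (n : nat) : set L :=
  [set f : L | (forall x, f x = 0%E \/ f x = 1%E) /\ cellwise_constant n f].

Definition M_dyadic (n : nat) : set L :=
  [set f : L | (forall x, range (fun m : nat => m%:R%:E) (f x)) /\
           cellwise_constant n f].

(* The maximum exists when [f] takes finite values; the default value of [xget]
   is irrelevant otherwise. *)
Definition eps_dyadic (n : nat) (f : L) : L :=
  xget (pom0 : L) [set g : L | [/\ M_dyadic n g, g <<< f &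
                            forall h, M_dyadic n h -> h <<< f -> (h <= g)%O]].

Definition basis_2infty (n : nat) : set L * (L -> L) :=
  (Lambda_dyadic n, eps_dyadic n).

End dyadic_basis.

Section distances.
Context (R : realType) (d : Order.disp_t) (T : pomType d).

Definition Cu_approx (X : topologicalType) (Lam : set (Lsc R X))
    (alpha beta : Lsc R X -> T) :=
  forall g' g, Lam g' -> Lam g -> g' <<< g ->
  (alpha g' <= beta g)%O /\ (beta g' <= alpha g)%O.

Definition dd_Cu (X : topologicalType)
    (B : nat -> set (Lsc R X) * (Lsc R X -> Lsc R X))
    (alpha beta : Lsc R X -> T) : \bar R :=
  ereal_inf [set (1 / 2 ^+ n)%:E |
             n in [set n : nat | (1 <= n)%N /\ Cu_approx (B n).1 alpha beta]].

Definition thickening (X : metricType R) (V : set X) (r : R) : set X :=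
  \bigcup_(x in V) ball x r.

Lemma open_thickening (X : metricType R) (V : set X) (r : R) :
  open (thickening V r).
Proof.
apply: bigcup_open => x _; rewrite openE => y; rewrite ballEmdist/= => xyr.
apply/nbhs_ballP; exists (r - mdist x y) => /=; first by rewrite subr_gt0.
move=> z; rewrite !ballEmdist/= ltrBrDl; apply: le_lt_trans.
exact: metric_triangle.
Qed.

Definition d_Cu (X : metricType R) (alpha beta : Lsc R X -> T) : \bar R :=
  ereal_inf [set r%:E | r in [set r : R | 0 < r /\
    forall (V : set X) (oV : open V),
      (alpha (Lsc_indic R oV) <= beta (Lsc_indic R (open_thickening V r)))%O /\
      (beta (Lsc_indic R oV) <= alpha (Lsc_indic R (open_thickening V r)))%O]].

End distances.

(* Main.v *)
(* With [h = 1 / 2 ^ n], the ball of radius [h] around a grid point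
   [i / 2 ^ n] consists of that point and the cells adjacent to it. For
   open sets of the compact metric space [X], [1_V <<< 1_W] holds exactly when
   the closure of [V] is contained in [W]. If [V] and [W] are moreover unions
   of cells and grid points, then already the [h]-thickening of [V] is contained
   in [W]; since [d_Cu <= h] only provides radii [r > h], this is applied to an
   exhaustion of [V] by smaller open sets, which gives (i) because morphisms
   preserve suprema. For (ii), any open [V] lies in some [W'] whose closure lies
   in some [W] contained in the [2 * h]-thickening of [V], where [W'] and [W]
   are both unions of cells and grid points. *)
Require Import Defs.
From mathcomp Require Import all_boot all_order all_algebra.
From mathcomp Require Import all_classical all_reals.
From mathcomp Require Import ereal topology normedtype sequences.
From mathcomp Require Import generic_quotient numfun lra.

Import Order.TTheory GRing.Theory Num.Theory.

Local Open Scope ring_scope.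

(** * Indicators of open sets and the relation [<<<] between them *)

Section indicators.
Set Implicit Arguments.
Unset Strict Implicit.
Local Open Scope classical_set_scope.
Context (R : realType).

Lemma nbar_ge1 (x : \bar R) : nbar x -> (0 < x)%E -> (1 <= x)%E.
Proof.
by move=> [[m _ <-]|->]; rewrite ?leey// lte_fin lee_fin ltr0n ler1n.
Qed.

Section topological.
Context (X : topologicalType).
Implicit Types V W : set X.

Lemma Lsc_nbar (f : Lsc R X) x : nbar (f x).
Proof. by have /asboolP[] := Lsc_funP f. Qed.

Lemma Lsc_open_gt (f : Lsc R X) (a : R) : open [set x | (a%:E < f x)%E].
Proof. by have /asboolP[/lower_semicontinuousP] := Lsc_funP f. Qed.

Lemma Lsc_indic1 V (oV : open V) x : V x -> Lsc_indic R oV x = 1%E.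
Proof. by move=> Vx; rewrite /= indicE mem_set. Qed.

Lemma Lsc_indic0 V (oV : open V) x : ~ V x -> Lsc_indic R oV x = 0%E.
Proof. by move=> Vx; rewrite /= indicE memNset. Qed.

Lemma Lsc_indic_leP V (oV : open V) (f : Lsc R X) :
  (Lsc_indic R oV <= f)%O <-> forall x, V x -> (1 <= f x)%E.
Proof.
split=> [/le_LscP h x Vx|h]; first by rewrite -(Lsc_indic1 oV Vx).
apply/le_LscP => x; have [Vx|Vx] := pselect (V x).
  by rewrite Lsc_indic1// h.
by rewrite Lsc_indic0//; exact/nbar_ge0/Lsc_nbar.
Qed.

Lemma Lsc_indic_le V W (oV : open V) (oW : open W) :
  (Lsc_indic R oV <= Lsc_indic R oW)%O <-> V `<=` W.
Proof.
rewrite Lsc_indic_leP; split=> h x Vx; last by rewrite Lsc_indic1//; exact: h.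
have := h x Vx; have [//|Wx] := pselect (W x).
by rewrite Lsc_indic0// lee_fin ler10.
Qed.

Lemma Lsc_01_indic (f : Lsc R X) : (forall x, f x = 0%E \/ f x = 1%E) ->
  exists (V : set X) (oV : open V), f = Lsc_indic R oV.
Proof.
move=> f01; exists [set x | (0%:E < f x)%E], (Lsc_open_gt f 0).
apply/val_inj/funext => x.
have [fx|fx] := f01 x; rewrite [LHS]fx.
  by rewrite [RHS]Lsc_indic0//= fx ltxx.
by rewrite [RHS]Lsc_indic1//= fx lte_fin ltr01.
Qed.

Lemma is_sup_Lsc_indic (Vs : nat -> set X) (oVs : forall k, open (Vs k))
    V (oV : open V) :
  V = \bigcup_k Vs k ->
  is_sup (fun k => Lsc_indic R (oVs k)) (Lsc_indic R oV).
Proof.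
move=> VE; split=> [_ [k _ <-]|g gub].
  by apply/Lsc_indic_le; rewrite VE; exact: bigcup_sup.
apply/Lsc_indic_leP => x; rewrite VE => -[k _ Vkx].
have /Lsc_indic_leP := gub _ (imageT (fun k => Lsc_indic R (oVs k)) k).
exact.
Qed.

Lemma nondecreasing_Lsc_indic (Vs : nat -> set X) (oVs : forall k, open (Vs k)) :
  (forall k, Vs k `<=` Vs k.+1) ->
  nondecreasing_seq (fun k => Lsc_indic R (oVs k)).
Proof.
by move=> h; apply/nondecreasing_seqP => k; apply/Lsc_indic_le.
Qed.

End topological.

Section metric.
Context (X : metricType R).
Implicit Types V W : set X.

Lemma closed_point (p : X) : closed [set p].
Proof. exact/accessible_closed_set1/hausdorff_accessible/metric_hausdorff. Qed.

(** At a point [p] of the closure outside [W], the open sets [Z k] of points of [W] farther than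
    [1 / (k + 1)] from [p] increase to [W]. Then [V] would lie in one of them, although it comes
    arbitrarily close to [p]. *)
Lemma way_below_indic_closure V W (oV : open V) (oW : open W) :
  Lsc_indic R oV <<< Lsc_indic R oW -> closure V `<=` W.
Proof.
move=> VW p clp; apply: contrapT => Wp.
pose Z k := W `&` [set x | k.+1%:R^-1 < mdist p x].
have oZ k : open (Z k).
  apply: openI => //; rewrite openE => x /= xp.
  apply/nbhs_ballP; exists (mdist p x - k.+1%:R^-1); first by rewrite /= subr_gt0.
  move=> y; rewrite ballEmdist/= => xy.
  have := metric_triangle p y x; rewrite (metric_sym y x) /=.
  by move: (k.+1%:R^-1 : R) xy => e; lra.
have incZ k : Z k `<=` Z k.+1.
  move=> x [Wx] /= h; split => //=; apply: le_lt_trans h.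
  by rewrite lef_pV2 ?posrE ?ltr0n// ler_nat.
have WE : W = \bigcup_k Z k.
  apply/seteqP; split=> [x Wx|x [k _ []//]].
  have px : 0 < mdist p x.
    rewrite lt_neqAle mdist_ge0 andbT eq_sym; apply/negP => /eqP/mdist_positivity E.
    by apply: Wp; rewrite E.
  have [k] := ltr_add_invr px; rewrite add0r => kx.
  by exists k.
have [k /Lsc_indic_le Vk] := VW _ _ (nondecreasing_Lsc_indic oZ incZ)
  (is_sup_Lsc_indic oZ oW WE) (lexx _).
have k0 : 0 < k.+1%:R^-1 :> R by rewrite invr_gt0 ltr0n.
have [x [/Vk[_ /= h]]] := clp _ (nbhsx_ballx p _ k0).
by rewrite ballEmdist /= => /(lt_trans h); rewrite ltxx.
Qed.

(* Order suprema in [Lsc] are not known to be pointwise; but if every term of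
   the sequence vanished at [x], lowering the supremum to [0] at [x] would give
   a smaller upper bound. *)
Lemma is_sup_Lsc_gt0 (z : nat -> Lsc R X) (s : Lsc R X) (x : X) :
  is_sup z s -> (0 < s x)%E -> exists k, (0 < z k x)%E.
Proof.
move=> [zs smin] sx; apply: contrapT => /forallNP z0.
pose s' y : \bar R := if y == x then 0%E else s y.
have s'P : s' \in @is_lsc R X.
  apply/asboolP; split=> [y a|y]; rewrite /s'; case: eqVneq => [yx|yx].
  - move=> a0; exists setT => [|w _]; first exact: filterT.
    by case: ifP => // _; rewrite (lt_le_trans a0)//; exact/nbar_ge0/Lsc_nbar.
  - move=> ay; exists ([set w | (a%:E < s w)%E] `&` ~` [set x]).
      apply: open_nbhs_nbhs; split; last by split=> //=; exact/eqP.
      apply: openI; first exact: Lsc_open_gt.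
      by rewrite openC; exact: closed_point.
    by move=> w [/= aw /eqP/negbTE->].
  - by left; exists 0%N.
  - exact: Lsc_nbar.
have : (s <= MkLsc s'P)%O.
  apply: smin => _ [k _ <-]; apply/le_LscP => y /=; rewrite /s'.
  case: eqVneq => [->|_]; first by rewrite leNgt; exact/negP.
  by have /le_LscP := zs _ (imageT z k); exact.
by move=> /le_LscP/(_ x) /=; rewrite /s' eqxx leNgt sx.
Qed.

(** The open sets where [z k] is positive increase and cover the compact set [closure V], so one of
    them contains it; positive values in [nbar] are at least [1]. *)
Lemma closure_way_below_indic V W (oV : open V) (oW : open W) :
  compact [set: X] -> closure V `<=` W -> Lsc_indic R oV <<< Lsc_indic R oW.
Proof.
move=> cX VW z s ndz zs /Lsc_indic_leP Ws.
have cV : compact (closure V).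
  by apply: (subclosed_compact _ cX) => //; exact: closed_closure.
have : \forall k \near \oo, closure V `<=` [set x | (0 < z k x)%E].
  move/compact_near_coveringP : cV; apply => x Vx.
  have [k zk] : exists k, (0 < z k x)%E.
    by apply: is_sup_Lsc_gt0 zs _; exact/(lt_le_trans lte01)/Ws/VW.
  exists ([set y | (0 < z k y)%E], [set i | (k <= i)%N]).
    split; last exact: nbhs_infty_ge.
    by apply: open_nbhs_nbhs; split=> //; exact: Lsc_open_gt.
  move=> [y i] [/= zky ki]; apply: (lt_le_trans zky).
  by have /le_LscP := ndz _ _ ki; exact.
move=> [k _ /(_ k (leqnn k)) h]; exists k; apply/Lsc_indic_leP => x Vx.
by apply: nbar_ge1; [exact: Lsc_nbar|exact/h/subset_closure].
Qed.

End metric.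
End indicators.

(** * Coordinates and metric on the interval and the circle *)

Section coordinates.
Set Implicit Arguments.
Unset Strict Implicit.
Import numFieldTopology.Exports numFieldNormedType.Exports.
Local Open Scope classical_set_scope.
Context (R : realType).
Implicit Types s t e : R.

Lemma clamp_subproof t :
  Num.min 1 (Num.max 0 t) \in (`[0, 1]%classic : set R).
Proof.
by rewrite inE/= in_itv/= le_min ge_min le_max ler01 !lexx.
Qed.

(** Makes the parametrisation [pt] total on the reals without increasing distances, so that
    coordinates are handled by plain real arithmetic. *)
Definition clamp t : unit_itv R := 
  exist (fun u : R => u \in (`[0, 1]%classic : set R)) _ (clamp_subproof t).

Lemma clamp_id t : 0 <= t <= 1 -> val (clamp t) = t.
Proof. by move=> /andP[t0 t1]; rewrite /= max_r// min_r. Qed.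

Lemma clamp_dist s t : `|val (clamp s) - val (clamp t)| <= `|s - t|.
Proof.
rewrite /=.
by case: (leP 0 s) => s0; case: (leP 0 t) => t0; rewrite ?(min_r ler01);
  do ?case: (leP 1 s) => s1; do ?case: (leP 1 t) => t1; do ?case: ger0P => ?; lra.
Qed.

Context (X : circle_or_interval).
Local Notation B := (base_space R X).

Definition pt t : B := base_proj X (clamp t).

Lemma ptP (x : B) : exists2 t, 0 <= t <= 1 & x = pt t.
Proof.
suff [u ->] : exists u, x = base_proj X u.
  exists (val u); first by have := valP u; rewrite inE/= in_itv.
  congr base_proj; apply/val_inj; rewrite clamp_id//.
  by have := valP u; rewrite inE/= in_itv.
rewrite /B in x *; case: X x => x /=; first by exists x.
by exists (repr (x : {eq_quot (@Defs.glue R)})%qT); rewrite /circle_pi reprK.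
Qed.

Lemma mdist_base_proj (u v : unit_itv R) :
  mdist (base_proj X u) (base_proj X v) =
  if X is Circle then arc_dist u v else `|val u - val v|.
Proof. by case: X => //=; exact: circle_dist_pi. Qed.

Lemma mdist_pt_le s t : mdist (pt s) (pt t) <= `|s - t|.
Proof.
rewrite mdist_base_proj; apply: le_trans (clamp_dist s t).
by case: X => //; rewrite /arc_dist ge_min lexx.
Qed.

Lemma mdist_pt_wrap s t : X = Circle -> 0 <= s <= 1 -> 0 <= t <= 1 ->
  mdist (pt s) (pt t) <= 1 - `|s - t|.
Proof.
move=> XC s01 t01; rewrite mdist_base_proj XC /arc_dist !clamp_id//.
by rewrite ge_min lexx orbT.
Qed.

Lemma mdist_pt_lt s t e : 0 <= s <= 1 -> 0 <= t <= 1 ->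
  mdist (pt s) (pt t) < e ->
  `|s - t| < e \/ X = Circle /\ 1 - `|s - t| < e.
Proof.
move=> s01 t01; rewrite mdist_base_proj; case: X; rewrite /arc_dist !clamp_id//.
  by left.
by rewrite gt_min => /orP[]; [left|right].
Qed.

(** Only endpoints are glued: for [t] inside and [s] different from [t], both [|s - t|] and
    [1 - |s - t|] are positive, hence so is the distance. *)
Lemma pt_inj s t : 0 <= s <= 1 -> 0 < t < 1 -> pt s = pt t -> s = t.
Proof.
move=> s01 t01 st.
have [//|] := eqVneq s t; rewrite -subr_eq0 -normr_gt0 => st0.
have d0 : mdist (pt s) (pt t) = 0 by rewrite st mdistxx.
have m0 : 0 < Num.min `|s - t| (1 - `|s - t|).
  by rewrite lt_min st0 /=; case: ger0P => ?; lra.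
have [| |h|[_ h]] := @mdist_pt_lt s t (Num.min `|s - t| (1 - `|s - t|)) s01.
- by lra.
- by rewrite d0.
- by move: h; rewrite lt_min ltxx.
- by move: h; rewrite lt_min ltxx andbF.
Qed.

Lemma pt01 : X = Circle -> pt 0 = pt 1.
Proof.
move=> XC; apply: mdist_positivity; apply/eqP; rewrite eq_le mdist_ge0 andbT.
have := @mdist_pt_wrap 0 1 XC.
by rewrite sub0r normrN normr1 subrr; apply; rewrite !lexx ler01.
Qed.

Lemma compact_base_space : compact [set: B].
Proof.
have -> : [set: B] = pt @` `[0, 1].
  by apply/seteqP; split=> // x _; have [t t01 ->] := ptP x; exists t.
apply: continuous_compact; last exact: segment_compact.
apply: continuous_subspaceT => t V /nbhs_ballP[e /= e0 eV].
apply/nbhs_ballP; exists e => //= s; rewrite /ball /= => ts.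
apply: eV; rewrite ballEmdist /=.
exact: le_lt_trans (mdist_pt_le _ _) ts.
Qed.

(** A path shorter than [a + b] joins [x] to [y]; the point dividing it in the ratio [a : b] serves
    as [z]. *)
Lemma ball_interpolation (x y : B) (a b : R) : 0 < a -> 0 < b ->
  mdist x y < a + b -> exists2 z, mdist x z < a & mdist z y < b.
Proof.
wlog : x y a b / exists s t, [/\ 0 <= s, s <= t, t <= 1, x = pt s & y = pt t].
  move=> wlg a0 b0; have [s s01 xE] := ptP x; have [t t01 yE] := ptP y.
  move: s01 t01 => /andP[s0 s1] /andP[t0 t1].
  case: (leP s t) => st; first by apply: wlg => //; exists s, t.
  rewrite metric_sym addrC => xy; have [| | |z yz zx] := wlg y x b a _ _ _ xy => //.
    by exists t, s; split=> //; exact: ltW.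
  by exists z; rewrite metric_sym.
move=> [s [t [s0 st t1 -> ->]]] a0 b0 d.
have s01 : 0 <= s <= 1 by lra.
have t01 : 0 <= t <= 1 by lra.
pose l D := a * D / (a + b).
have lP D : 0 <= D -> D < a + b -> [/\ 0 <= l D, l D < a, l D <= D & D - l D < b].
  move=> D0 Dab; have ab0 : 0 < a + b by lra.
  have E : l D * (a + b) = a * D by rewrite /l mulfVK// gt_eqF.
  by split; rewrite ?mulr_ge0 ?invr_ge0//; nra.
have [|[XC]] := mdist_pt_lt s01 t01 d; rewrite ler0_norm ?opprB; try lra.
  move=> h; have [| |] := lP (t - s); [lra|lra|].
  move: (l _) => c c0 ca cts cb; exists (pt (s + c)).
    by apply: le_lt_trans (mdist_pt_le _ _) _; rewrite ler0_norm; lra.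
  by apply: le_lt_trans (mdist_pt_le _ _) _; rewrite ler0_norm; lra.
(* Here the path runs through the glued point, from [s] down to [0] and from [1] down to [t]. After
   length [c] it is at [s - c] or, past the glued point, at [1 - (c - s)]. *)
move=> h; have [| |] := lP (1 - (t - s)); [lra|lra|].
move: (l _) => c c0 ca cts cb; case: (leP c s) => cs.
  exists (pt (s - c)).
    by apply: le_lt_trans (mdist_pt_le _ _) _; rewrite ger0_norm; lra.
  apply: le_lt_trans (mdist_pt_wrap XC _ _) _ => //; first lra.
  by rewrite ler0_norm; lra.
exists (pt (1 - (c - s))).
  apply: le_lt_trans (mdist_pt_wrap XC _ _) _ => //; first lra.
  by rewrite ler0_norm; lra.
by apply: le_lt_trans (mdist_pt_le _ _) _; rewrite ger0_norm; lra.
Qed.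

End coordinates.

(** * The dyadic grid and its open cells *)

Definition mesh (R : realType) (n : nat) : R := (2 ^+ n)^-1.

Section grid.
Set Implicit Arguments.
Unset Strict Implicit.
Import numFieldTopology.Exports numFieldNormedType.Exports.
Local Open Scope classical_set_scope.
Context (R : realType) (X : circle_or_interval) (n : nat).
Local Notation B := (base_space R X).
Local Notation h := (mesh R n).
Local Notation U := (@cell R X n).
Local Notation pt := (@pt R X).

Definition grid : set B := [set pt (i%:R * h) | i in [set i | (i <= 2 ^ n)%N]].

Lemma mesh_gt0 : 0 < h.
Proof. by rewrite invr_gt0 exprn_gt0. Qed.

Lemma mesh_total : (2 ^ n)%N%:R * h = 1.
Proof. by rewrite natrX /mesh mulfV// expf_neq0// pnatr_eq0. Qed.

Lemma grid_itv i : (i <= 2 ^ n)%N -> 0 <= i%:R * h <= 1.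
Proof.
move=> ile; rewrite mulr_ge0 ?(ltW mesh_gt0)//= -[leRHS]mesh_total.
by rewrite ler_wpM2r ?(ltW mesh_gt0)// ler_nat.
Qed.

Lemma itv_grid i : i%:R * h <= 1 -> (i <= 2 ^ n)%N.
Proof. by rewrite -[leRHS]mesh_total ler_pM2r ?mesh_gt0// ler_nat. Qed.

(** The bounds [0 < t < 1] hold for every [k], since indices outside the range from [1] to [2 ^ n]
    give empty cells; they make [pt_inj] applicable to cell points. *)
Lemma cellP k x : U k x <->
  exists t, [/\ 0 < t < 1, k%:R * h - h < t, t < k%:R * h & x = pt t].
Proof.
have h0 := mesh_gt0.
split=> [[u /=]|[t [t01 kt tk ->]]].
  rewrite -/(mesh R n) mulrBl mul1r -![sval u]/(val u) => -[ku uk] <-.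
  have u01 : 0 <= val u <= 1 by have := valP u; rewrite inE/= in_itv.
  have k0 : (0 < k)%N.
    by rewrite -(ltr0n R) -(pmulr_lgt0 _ h0); lra.
  have kN : (k <= 2 ^ n)%N.
    rewrite -ltnS -(ltr_nat R) -(ltr_pM2r h0) -natr1 mulrDl mesh_total; lra.
  have h1 : h <= k%:R * h by rewrite ler_peMl ?(ltW h0)// ler1n.
  have /andP[_ h2] := grid_itv kN.
  exists (val u); split=> //; first by lra.
  by congr base_proj; apply/val_inj; rewrite clamp_id.
exists (clamp t) => //=; rewrite -/(mesh R n) mulrBl mul1r.
by rewrite -[Num.min _ _]/(val (clamp t)) clamp_id//; lra.
Qed.

Lemma cell_range k x : U k x -> (1 <= k <= 2 ^ n)%N.
Proof.
have h0 := mesh_gt0.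
move=> /cellP[t [t01 kt tk _]]; apply/andP; split.
  by rewrite -(ltr0n R) -(pmulr_lgt0 _ h0); lra.
by rewrite -ltnS -(ltr_nat R) -(ltr_pM2r h0) -natr1 mulrDl mesh_total; lra.
Qed.

Lemma cell_ball_grid k x : U k x -> exists2 p, grid p & ball p h x.
Proof.
move=> Ux; have /andP[_ kN] := cell_range Ux.
have /cellP[t [t01 kt tk ->]] := Ux; exists (pt (k%:R * h)); first by exists k.
rewrite ballEmdist/=; apply: le_lt_trans (mdist_pt_le _ _ _) _.
by rewrite ger0_norm; lra.
Qed.

Lemma cell_eq j k x : U j x -> U k x -> j = k.
Proof.
have h0 := mesh_gt0.
move=> /cellP[s [s01 js sj ->]] /cellP[t [t01 kt tk st]].
have {}st : s = t by apply: pt_inj st; lra.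
have aux i l : i%:R * h - h < l%:R * h -> (i <= l)%N.
  by move=> il; rewrite -ltnS -(ltr_nat R) -(ltr_pM2r h0) -natr1 mulrDl; lra.
by apply/eqP; rewrite eqn_leq !aux//; lra.
Qed.

Lemma grid_not_cell k p : grid p -> ~ U k p.
Proof.
have h0 := mesh_gt0.
move=> [i /= iN <-] /cellP[t [t01 kt tk it]].
have {}it : i%:R * h = t by apply: pt_inj it => //; exact: grid_itv.
have ik : (i < k)%N by rewrite -(ltr_nat R) -(ltr_pM2r h0); lra.
suff : (k < i.+1)%N by rewrite ltnS leqNgt ik.
by rewrite -(ltr_nat R) -(ltr_pM2r h0) -natr1 mulrDl; lra.
Qed.

Lemma open_cell k : open (U k).
Proof.
have h0 := mesh_gt0.
rewrite openE => x /cellP[t [t01 kt tk ->]].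
have /andP[k1 kN] : (1 <= k <= 2 ^ n)%N by apply: cell_range; apply/cellP; exists t.
have h1 : h <= k%:R * h by rewrite ler_peMl ?(ltW h0)// ler1n.
have /andP[_ h2] := grid_itv kN.
(* The radius is the distance from [t] to the nearer end of its cell; it also excludes paths through
   the glued point. *)
apply/nbhs_ballP; exists (Num.min (t - (k%:R * h - h)) (k%:R * h - t)).
  by rewrite /= lt_min; apply/andP; split; lra.
move=> y; have [s s01 ->] := ptP y; rewrite ballEmdist/=.
have tt : 0 <= t <= 1 by lra.
move=> /(mdist_pt_lt tt s01)[|].
  rewrite lt_min => H; apply/cellP; exists s.
  by move: H; case: ger0P => ? /andP[? ?]; split => //; lra.
by move=> [_]; rewrite lt_min; case: ger0P => ? /andP[? ?]; lra.
Qed.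

Lemma cell_near_gridpoint i t : (i <= 2 ^ n)%N -> 0 <= t <= 1 ->
    t != i%:R * h -> `|i%:R * h - t| < h ->
  exists k, [/\ U k (pt t), U k `<=` ball (pt (i%:R * h)) h &
                closure (U k) (pt (i%:R * h))].
Proof.
have h0 := mesh_gt0.
move=> iN t01 ti di; have /andP[i0 i1] := grid_itv iN.
(* The cells left and right of grid point [i] have indices [i] and [i.+1]. *)
exists (if t < i%:R * h then i else i.+1).
have sub k : (k = i) \/ (k = i.+1) -> U k `<=` ball (pt (i%:R * h)) h.
  move=> ki x /cellP[s [s01 ks sk ->]]; rewrite ballEmdist/=.
  apply: le_lt_trans (mdist_pt_le _ _ _) _.
  case: ki ks sk => ->; rewrite -?natr1 ?mulrDl ?mul1r => ks sk.
    by rewrite ger0_norm; lra.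
  by rewrite ler0_norm; lra.
have near k : (forall e, 0 < e -> exists s, U k (pt s) /\ `|i%:R * h - s| < e) ->
    closure (U k) (pt (i%:R * h)).
  move=> H V /nbhs_ballP[e /= /H[s [Us ise]] eV].
  exists (pt s); split=> //; apply: eV; rewrite ballEmdist /=.
  exact: le_lt_trans (mdist_pt_le _ _ _) _.
case: (ltP t (i%:R * h)) ti di => [lti _|]; last rewrite le_eqVlt eq_sym.
  rewrite ger0_norm ?subr_ge0 ?(ltW lti)// => di.
  have hi : h <= i%:R * h.
    by rewrite ler_peMl ?(ltW h0)// ler1n -(ltr0n R) -(pmulr_lgt0 _ h0); lra.
  split.
  - by apply/cellP; exists t; split=> //; lra.
  - by apply: sub; left.
  - apply: near => e e0; exists (Num.max t (i%:R * h - e / 2)).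
    case: (leP t (i%:R * h - e / 2)) => H; (split; last by rewrite ger0_norm; lra).
    + by apply/cellP; exists (i%:R * h - e / 2); split => //; lra.
    + by apply/cellP; exists t; split => //; lra.
move=> /orP[-> //|lti] _; rewrite ltr0_norm ?subr_lt0// => di.
have iS : i.+1%:R * h = i%:R * h + h by rewrite -natr1 mulrDl mul1r.
have iN1 : i.+1%:R * h <= 1.
  have /andP[//] : 0 <= i.+1%:R * h <= 1; apply: grid_itv.
  by rewrite -(ltr_nat R) -(ltr_pM2r h0) mesh_total; lra.
split.
- by apply/cellP; exists t; split=> //; lra.
- by apply: sub; right.
- apply: near => e e0; exists (Num.min t (i%:R * h + e / 2)).
  case: (leP t (i%:R * h + e / 2)) => H; (split; last by rewrite ler0_norm; lra).
  + by apply/cellP; exists t; split => //; lra.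
  + by apply/cellP; exists (i%:R * h + e / 2); split => //; lra.
Qed.

Lemma ball_gridP p y : grid p -> ball p h y ->
  y = p \/ exists k, [/\ U k y, U k `<=` ball p h & closure (U k) p].
Proof.
have h0 := mesh_gt0.
move=> [i /= iN <-]; have [t t01 ->] := ptP y; rewrite {1}ballEmdist/= => d.
have i01 := grid_itv iN.
(* On the circle the point [0] is also the grid point [1]. *)
have [j [jN -> dj]] : exists j, [/\ (j <= 2 ^ n)%N,
    pt (i%:R * h) = pt (j%:R * h) & `|j%:R * h - t| < h].
  have [?|[XC]] := mdist_pt_lt i01 t01 d; first by exists i.
  (* Closeness through the glued point forces [i] to be [2 ^ n] or [0]; [j] is then the opposite
     endpoint. *)
  have [->|iN'] := eqVneq i (2 ^ n)%N.
    exists 0%N; rewrite mesh_total mul0r pt01//; split => //.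
    by rewrite sub0r normrN; move: b; rewrite mesh_total !ger0_norm; lra.
  have iS : i%:R * h + h <= 1.
    have -> : i%:R * h + h = i.+1%:R * h by rewrite -natr1 mulrDl mul1r.
    by have /andP[] : 0 <= i.+1%:R * h <= 1 by apply: grid_itv; rewrite ltn_neqAle iN'.
  case: ger0P => it dd; first by exfalso; lra.
  have i0 : i = 0%N.
    apply/eqP; rewrite -leqn0 -ltnS -(ltr_nat R) -(ltr_pM2r h0) mul1r; lra.
  exists (2 ^ n)%N; rewrite mesh_total i0 mul0r pt01//; split => //.
  by move: dd; rewrite i0 mul0r ger0_norm; lra.
have [->|tj] := eqVneq t (j%:R * h); [by left|right].
exact: cell_near_gridpoint.
Qed.

(** A path shorter than the mesh joins the two points. A grid point on it is within [h] of both; if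
    there is none, the path stays inside one cell. *)
Lemma near_point (x y : B) : mdist x y < h ->
  (exists k, U k x /\ U k y) \/
  exists p, [/\ grid p, ball p h x & ball p h y].
Proof.
have h0 := mesh_gt0.
wlog : x y / exists s t, [/\ 0 <= s, s <= t, t <= 1, x = pt s & y = pt t].
  move=> wlg; have [s s01 xE] := ptP x; have [t t01 yE] := ptP y.
  move: s01 t01 => /andP[s0 s1] /andP[t0 t1].
  case: (leP s t) => st; first by apply: wlg => //; exists s, t.
  rewrite metric_sym => /wlg[|[k [? ?]]|[p [? ? ?]]].
  - by exists t, s; split=> //; exact: ltW.
  - by left; exists k.
  - by right; exists p.
move=> [s [t [s0 st t1 -> ->]]] d.
have [||st'|[XC d']] := mdist_pt_lt _ _ d; [lra|lra| |]; last first.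
  (* The short path passes through the glued point, which is the grid point [pt 0]. *)
  right; exists (pt 0); split.
  - by exists 0%N => //; rewrite mul0r.
  - rewrite ballEmdist/=; apply: le_lt_trans (mdist_pt_le _ _ _) _.
    by rewrite ler0_norm; move: d'; rewrite ?ler0_norm; lra.
  - rewrite ballEmdist/=; apply: le_lt_trans (mdist_pt_wrap XC _ _) _; try lra.
    by rewrite ler0_norm; move: d'; rewrite ?ler0_norm; lra.
have : 0 <= s / h by rewrite divr_ge0// ltW.
move=> /truncn_itv; set i := Num.truncn _.
rewrite ler_pdivlMr// ltr_pdivrMr// -natr1 mulrDl mul1r => /andP[is_ si].
move: st'; rewrite ler0_norm; last by lra.
move=> st'; have [si'|si'] := eqVneq s (i%:R * h).
  right; exists (pt (i%:R * h)); split.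
  - by exists i => //=; apply: itv_grid; lra.
  - by rewrite ballEmdist/= si' mdistxx.
  - rewrite ballEmdist/=; apply: le_lt_trans (mdist_pt_le _ _ _) _.
    by rewrite ler0_norm; lra.
have {}is_ : i%:R * h < s by rewrite lt_neqAle eq_sym si'.
have iS : i.+1%:R * h = i%:R * h + h by rewrite -natr1 mulrDl mul1r.
have i0 : 0 <= i%:R * h by rewrite mulr_ge0// ltW.
have /andP[_ iN] : 0 <= i.+1%:R * h <= 1.
  by apply: grid_itv; rewrite -(ltr_nat R) -(ltr_pM2r h0) mesh_total; lra.
have [ti|ti] := ltP t (i.+1%:R * h).
  left; exists i.+1; split; apply/cellP; [exists s|exists t]; split => //; lra.
right; exists (pt (i.+1%:R * h)); split.
- by exists i.+1 => //=; apply: itv_grid; lra.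
- rewrite ballEmdist/=; apply: le_lt_trans (mdist_pt_le _ _ _) _.
  by rewrite ger0_norm; lra.
- rewrite ballEmdist/=; apply: le_lt_trans (mdist_pt_le _ _ _) _.
  by rewrite ler0_norm; lra.
Qed.
End grid.

(** * Unions of cells and grid points *)

Section saturated.
Set Implicit Arguments.
Unset Strict Implicit.
Local Open Scope classical_set_scope.
Context (R : realType) (X : circle_or_interval) (n : nat).
Local Notation B := (base_space R X).
Local Notation h := (mesh R n).
Local Notation U := (@cell R X n).
Local Notation grid := (@grid R X n).
Implicit Types V W : set B.

(** Set-level form of membership in [Lambda_dyadic n], whose elements are exactly the indicators of
    saturated open sets. *)
Definition saturated V := forall k x y, U k x -> U k y -> V x -> V y.

Lemma saturated_Lambda V (oV : open V) :
  saturated V -> Lambda_dyadic n (Lsc_indic R oV).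
Proof.
move=> sV; split=> [x|k _ x y Ux Uy].
  by have [Vx|Vx] := pselect (V x); [right; exact: Lsc_indic1|left; exact: Lsc_indic0].
have [Vx|Vx] := pselect (V x).
  by rewrite (Lsc_indic1 R oV Vx) (Lsc_indic1 R oV (sV _ _ _ Ux Uy Vx)).
have Vy : ~ V y by move=> /(sV _ _ _ Uy Ux).
by rewrite (Lsc_indic0 R oV Vx) (Lsc_indic0 R oV Vy).
Qed.

Lemma Lambda_saturated (f : Lsc R B) : Lambda_dyadic n f ->
  exists V (oV : open V), f = Lsc_indic R oV /\ saturated V.
Proof.
move=> [/Lsc_01_indic[V [oV ->]] cst]; exists V, oV; split=> // k x y Ux Uy Vx.
have := cst k (cell_range Ux) x y Ux Uy; rewrite Lsc_indic1//.
have [//|Vy] := pselect (V y); rewrite Lsc_indic0// => /eqP.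
by rewrite eqe oner_eq0.
Qed.

(** If no cell contains both [x] and [y], they are within [h] of a common grid point [p]. Then [p]
    is in [closure V], as it equals [x] or adjoins the cell of [x], which lies in [V]. So [p] is in
    the open set [W], which meets the cell of [y] (unless [y] is [p]) and therefore contains it. *)
Lemma thickening_saturated V W : open V -> open W -> saturated V -> saturated W ->
  closure V `<=` W -> thickening V h `<=` W.
Proof.
move=> oV oW sV sW VW y [x Vx]; rewrite /= ballEmdist => /near_point.
move=> [[k [Ux Uy]]|[p [gp px py]]].
  by apply/VW/subset_closure; exact: sV _ _ _ Ux Uy Vx.
have Wp : W p.
  apply: VW; have [xp|[k [Ux _ clp]]] := ball_gridP gp px.
    by rewrite -xp; exact: subset_closure.
  by apply: closureS clp => z Uz; exact: sV _ _ _ Ux Uz Vx.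
have [->//|[k [Uy _ clp]]] := ball_gridP gp py.
have [z [Uz Wz]] := clp W (open_nbhs_nbhs (conj oW Wp)).
exact: sW _ _ _ Uz Uy Wz.
Qed.

Lemma cell_sub_ball k p y : grid p -> U k y -> ball p h y -> U k `<=` ball p h.
Proof.
move=> gp Uy /(ball_gridP gp)[yp|[j [Ujy Ub _]]].
  by case: (grid_not_cell (k := k) gp); rewrite -yp.
by rewrite (cell_eq Uy Ujy).
Qed.

Lemma cell_or_grid x : (exists k, U k x) \/ grid x.
Proof.
have [|[k [Ux _]]|[p [gp px _]]] := @near_point R X n x x.
- by rewrite mdistxx; exact: mesh_gt0.
- by left; exists k.
- by have [->|[k [Ux _ _]]] := ball_gridP gp px; [right|left; exists k].
Qed.

Lemma cells_dense x : closure (\bigcup_k U k) x.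
Proof.
have [[k Ux]|gx] := cell_or_grid x.
  by apply: subset_closure; exists k.
have h0 := mesh_gt0 R n; have ht := mesh_total R n.
have [i /= iN xE] := gx.
(* [t] lies half a mesh step left of the grid point, or right of it if [i] is [0]. *)
have [t [t01 tn td]] : exists t, [/\ 0 <= t <= 1, t != i%:R * h & `|i%:R * h - t| < h].
  have h1 : h <= 1.
    by have := @grid_itv R n 1; rewrite mul1r expn_gt0 => /(_ isT)/andP[].
  have /andP[i0 i1] := grid_itv R iN.
  have [|] := leP h (i%:R * h) => hi.
    exists (i%:R * h - h / 2); split; first by lra.
      by rewrite lt_eqF//; lra.
    by rewrite ger0_norm; lra.
  exists (h / 2 + i%:R * h); split.
  - have i0' : i = 0%N.
      by apply/eqP; rewrite -leqn0 -ltnS -(ltr_nat R) -(ltr_pM2r h0) mul1r; lra.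
    by rewrite i0' mul0r; lra.
  - by rewrite gt_eqF//; lra.
  - by rewrite ler0_norm; lra.
have [k [_ _]] := cell_near_gridpoint X iN t01 tn td.
by rewrite xE; apply: closureS => z Uz; exists k.
Qed.

(* [W'] is the interior of the closure of the union of the cells meeting [V],
   and [W] the union of those mesh-balls around grid points that meet [V]. *)
Lemma saturated_sandwich V : open V ->
  exists W' W, [/\ open W', open W, saturated W', saturated W &
    [/\ V `<=` W', closure W' `<=` W & W `<=` thickening V (2 * h)]].
Proof.
move=> oV.
pose C := \bigcup_(k in [set k | U k `&` V !=set0]) U k.
pose P := [set p | grid p /\ ball p h `&` V !=set0].
have oC : open C by apply: bigcup_open => k _; exact: open_cell.
have meetsC k : U k `&` C !=set0 -> U k `&` V !=set0.
  by move=> [x [Ux [j /= jV Ujx]]]; rewrite (cell_eq Ux Ujx).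
have CW' : C `<=` (closure C)° by rewrite -open_subsetE//; exact: subset_closure.
(* [C] misses the grid points of [V]; the interior of its closure fills them in. *)
exists (closure C)°, (thickening P h); split.
- exact: open_interior.
- exact: open_thickening.
- move=> k x y Ux Uy /interior_subset clx.
  (* A cell is open, so if it meets [closure C] it meets [C], and then it is one of the cells making
     up [C]. *)
  suff : C y by apply: CW'.
  exists k => //=; apply: meetsC.
  have [z [Cz Uz]] := clx (U k) (open_nbhs_nbhs (conj (@open_cell R X n k) Ux)).
  by exists z.
- move=> k x y Ux Uy [p [gp pV] px]; exists p => //.
  exact: cell_sub_ball px _ Uy.
split.
(* Since [V] is open and the cells are dense, each neighbourhood of [x] contains a point of [V] in
   some cell, and this cell is part of [C]. *)
- rewrite -open_subsetE// => x Vx N Nx.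
  have [y [[k _ Uy] [Ny Vy]]] := cells_dense (filterI Nx (open_nbhs_nbhs (conj oV Vx))).
  by exists y; split=> //; exists k => //; exists y.
- move=> x /(closureS (@interior_subset _ _)).
  rewrite -(closure_id _).1; last exact: closed_closure.
  move=> clx.
  have [[k Ux]|gx] := cell_or_grid x.
    have /meetsC[v [Uv Vv]] : U k `&` C !=set0.
      have [z [Cz Uz]] := clx (U k) (open_nbhs_nbhs (conj (@open_cell R X n k) Ux)).
      by exists z.
    have [p gp px] := cell_ball_grid Ux.
    exists p => //; split => //; exists v; split => //.
    exact: cell_sub_ball px _ Uv.
  (* A grid point serves as its own centre: its mesh-ball meets a cell of [C], hence contains that
     cell and meets [V]. *)
  exists x; last by apply: ballxx; exact: mesh_gt0.
  have [z [[k /= kV Uz] xz]] := clx _ (nbhsx_ballx x _ (mesh_gt0 R n)).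
  split=> //; have [v [Uv Vv]] := kV; exists v; split => //.
  exact: cell_sub_ball xz _ Uv.
- move=> y [p [gp [v [pv Vv]]] py]; exists v => //.
  move: pv py; rewrite !ballEmdist/= => pv py.
  rewrite (le_lt_trans (metric_triangle _ p _))// metric_sym; lra.
Qed.
End saturated.

(** * Passing between [Lambda_dyadic] and thickenings *)

Section comparison.
Set Implicit Arguments.
Unset Strict Implicit.
Local Open Scope classical_set_scope.
Context (R : realType) (d : Order.disp_t) (T : pomType d).

(** One of the two symmetric inequalities in [d_Cu], separated so that one argument serves both
    orders of the morphisms. *)
Definition dominated_at (X : metricType R) (alpha beta : Lsc R X -> T) (r : R) :=
  forall (V : set X) (oV : open V),
    (alpha (Lsc_indic R oV) <= beta (Lsc_indic R (open_thickening V r)))%O.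

Context (X : circle_or_interval) (n : nat).
Local Notation B := (base_space R X).
Local Notation h := (mesh R n).
Implicit Types alpha beta : Lsc R B -> T.

(* Shrinking [V'] by [1 / (k + 1)] leaves room for the excess of [r] over [h]. *)
Lemma dominated_Lambda alpha beta :
    Cu_morphism alpha -> Cu_morphism beta ->
    (forall e, h < e -> exists2 r, r < e & dominated_at alpha beta r) ->
  forall g' g, Lambda_dyadic n g' -> Lambda_dyadic n g -> g' <<< g ->
  (alpha g' <= beta g)%O.
Proof.
move=> aCu bCu dom g' g /Lambda_saturated[V [oV [-> sV]]].
move=> /Lambda_saturated[W [oW [-> sW]]] /way_below_indic_closure VW.
(* The interior is taken because the points whose open ball of fixed radius lies in [V] need not
   form an open set. *)
pose Vs k := [set x | ball x k.+1%:R^-1 `<=` V]°.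
have k0 k : 0 < k.+1%:R^-1 :> R by rewrite invr_gt0 ltr0n.
have oVs k : open (Vs k) by exact: open_interior.
have incVs k : Vs k `<=` Vs k.+1.
  apply: interiorS => x /=; apply: subset_trans; apply: le_ball.
  by rewrite lef_pV2 ?posrE ?ltr0n// ler_nat.
have VE : V = \bigcup_k Vs k.
  apply/seteqP; split=> [x Vx|x [k _ /interior_subset]]; last first.
    by apply; exact: ballxx.
  have /nbhs_ballP[e /= e0 eV] := open_nbhs_nbhs (conj oV Vx).
  have [k] := ltr_add_invr (divr_gt0 e0 (ltr0n R 2)); rewrite add0r => ke.
  exists k => //; apply/nbhs_ballP; exists (e / 2) => /=; first by lra.
  move=> y xy z yz; apply: eV; rewrite (splitr e).
  exact: ball_triangle xy (le_ball (ltW ke) yz).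
have [_ lub] := Cu_morph_sup aCu (nondecreasing_Lsc_indic R oVs incVs)
  (is_sup_Lsc_indic R oVs oV VE).
apply: lub => _ [k _ <-] /=.
have [|r rh /(_ _ (oVs k))/le_trans] := dom (h + k.+1%:R^-1).
  by rewrite ltrDl.
apply; apply: (Cu_morph_le bCu); apply/Lsc_indic_le => y [x Vkx].
rewrite /= ballEmdist /= => /lt_trans/(_ rh); rewrite addrC => xy.
(* The distance below [h + 1 / (k + 1)] splits at [z]: the first part stays in [V] by the choice of
   [Vs k], the second is less than [h]. *)
have [z xz zy] := ball_interpolation (k0 k) (mesh_gt0 R n) xy.
apply: (thickening_saturated oV oW sV sW VW).
exists z; last by rewrite /= ballEmdist.
by apply: (interior_subset Vkx); rewrite ballEmdist.
Qed.

(** The morphisms are applied along the chain [1_V <= 1_V' <<< 1_W <= 1_(V_2h)] from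
    [saturated_sandwich] and compared at its middle link. *)
Lemma Cu_approx_dominated alpha beta :
    Cu_morphism alpha -> Cu_morphism beta ->
    Cu_approx (Lambda_dyadic n) alpha beta ->
  dominated_at alpha beta (2 * h) /\ dominated_at beta alpha (2 * h).
Proof.
move=> aCu bCu ab; suff aux V (oV : open V) :
    (alpha (Lsc_indic R oV) <=
      beta (Lsc_indic R (open_thickening V (2 * h))))%O /\
    (beta (Lsc_indic R oV) <=
      alpha (Lsc_indic R (open_thickening V (2 * h))))%O.
  by split=> V oV; have [] := aux V oV.
have [V' [W [oV' oW sV' sW [VV' V'W WV]]]] := saturated_sandwich n oV.
have [abVW baVW] := ab _ _ (saturated_Lambda oV' sV') (saturated_Lambda oW sW)
  (closure_way_below_indic oV' (@compact_base_space R X) V'W).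
have le1 := (Lsc_indic_le R oV oV').2 VV'.
have le2 := (Lsc_indic_le R oW (open_thickening V (2 * h))).2 WV.
split.
  by apply: le_trans (Cu_morph_le aCu le1) (le_trans abVW (Cu_morph_le bCu le2)).
by apply: le_trans (Cu_morph_le bCu le1) (le_trans baVW (Cu_morph_le aCu le2)).
Qed.

End comparison.

(** * From the comparison of morphisms to the two infima *)

Theorem proposition5p6 (R : realType) (X : circle_or_interval)
    (d : Order.disp_t) (T : cuSemigroupType d)
    (alpha beta : Lsc R (base_space R X) -> T)
    (alpha_Cu : Cu_morphism alpha) (beta_Cu : Cu_morphism beta)
    (n : nat) (n_ge1 : (1 <= n)%N) :
  ((d_Cu alpha beta <= (1 / 2 ^+ n)%:E)%E ->
     (dd_Cu (basis_2infty R X) alpha beta <= (1 / 2 ^+ n)%:E)%E) /\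
  ((dd_Cu (basis_2infty R X) alpha beta <= (1 / 2 ^+ n)%:E)%E ->
     (d_Cu alpha beta <= (2 / 2 ^+ n)%:E)%E /\
     2 / 2 ^+ n <= 1 / 2 ^+ (n - 1) :> R).
Proof.
have meshE m : (2 ^+ m)^-1 = mesh R m by [].
have meshS m : mesh R m = 2 * mesh R m.+1.
  by rewrite /mesh exprS invfM mulrA mulfV ?mul1r// pnatr_eq0.
split=> [dle|ddle].
  apply: ereal_inf_lbound; exists n => //; split=> //.
  (* The infimum [d_Cu] need not be attained, so it only yields a radius below each
     [e > mesh R n]. *)
  have dom e : mesh R n < e -> exists2 r, r < e &
      dominated_at alpha beta r /\ dominated_at beta alpha r.
    move=> he; have : (d_Cu alpha beta < e%:E)%E.
      by rewrite (le_lt_trans dle)// lte_fin mul1r.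
    move=> /ereal_inf_lt[_ [r [_ rP] <-]]; rewrite lte_fin => re.
    by exists r => //; split=> V oV; have [] := rP V oV.
  move=> g' g Lg' Lg g'g; split.
    apply: (dominated_Lambda alpha_Cu beta_Cu _ Lg' Lg g'g) => e /dom[r re []].
    by exists r.
  apply: (dominated_Lambda beta_Cu alpha_Cu _ Lg' Lg g'g) => e /dom[r re []].
  by exists r.
split; last first.
  by case: n n_ge1 {ddle} => // m _; rewrite subn1 /= mul1r !meshE (meshS m).
(* The factor [2] makes the inequality strict, so the comparison holds at some level [m] with
   [1 / 2 ^ m < 2 / 2 ^ n]; between powers of two this forces [m >= n]. *)
have : (dd_Cu (basis_2infty R X) alpha beta < (2 / 2 ^+ n)%:E)%E.
  by rewrite (le_lt_trans ddle)// lte_fin ltr_pM2r ?meshE ?mesh_gt0// ltr1n.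
move=> /ereal_inf_lt[_ [m [_ apx] <-]]; rewrite lte_fin mul1r !meshE => mn.
have {mn} nm : mesh R m <= mesh R n.
  move: mn; rewrite /mesh.
  case: n n_ge1 {ddle} => // k _; rewrite !meshE -meshS /mesh.
  rewrite ltf_pV2 ?posrE ?exprn_gt0// ltr_eXn2l ?ltr1n// => km.
  by rewrite lef_pV2 ?posrE ?exprn_gt0// ler_eXn2l ?ltr1n.
apply: (@le_trans _ _ (2 * mesh R m)%:E); last first.
  by rewrite lee_fin ler_pM2l.
apply: ereal_inf_lbound; exists (2 * mesh R m) => //.
have [dab dba] := Cu_approx_dominated alpha_Cu beta_Cu apx.
by split=> [|V oV]; [rewrite mulr_gt0// mesh_gt0|split; [exact: dab|exact: dba]].
Qed.
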